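(* Let ${\sf Lattice}$ be the following formula about a countable partial order $P$: $$\forall a,b\in P\ \exists c,d\in P\ \forall e\in P\ \big[c\le_P a,b\le_P d\ \wedge\ (e\le_P a,b\to e\le_P c)\ \wedge\ (a,b\le_P e\to d\le_P e)\big].$$ Then ${\sf Lattice}$ is $\forall\forall^\infty$-dicomplete.
   Context: Quantifiers range over $\omega$. $\exists^\infty n\,\varphi(n)$ means $\forall m\exists n\ge m\,\varphi(n)$ and $\forall^\infty n\,\varphi(n)$ means $\exists m\forall n\ge m\,\varphi(n)$. A quantifier-pattern is a finite string $\bar{\mathsf Q}=\mathsf Q_0\dots\mathsf Q_\ell$ over $\{\exists,\forall,\exists^\infty,\forall^\infty\}$. A $\bar{\mathsf Q}$-formula is $\varphi(\bar x)\equiv\mathsf Q_0n_0\dots\mathsf Q_\ell n_\ell\,\theta(n_0,\dots,n_\ell,\bar x)$ with $\theta$ a bounded formula. The instance $\bar x$ is a tuple of natural numbers and/or total computable functions (computable elements of $\omega^\omega$). Spaces such as $\omega\times\omega^\omega$, $(\omega^\omega)^\omega$, $\omega^{\omega\times\omega}$ are identified with $\omega^\omega$ by computable pairing. Witnesses: for $\alpha\in\omega^\omega$, $\alpha\Vdash\varphi(\bar x)$ (''$\alpha$ is a witness for $\varphi(\bar x)$'') is defined by: $\alpha\Vdash\theta(\bar x)$ iff $\alpha=\bar x$ and $\theta(\bar x)$, for bounded $\theta$; $\langle t,\alpha\rangle\Vdash\exists n\varphi(n,\bar x)$ iff $\alpha\Vdash\varphi(t,\bar x)$; $\alpha\Vdash\forall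 n\varphi(n,\bar x)$ iff $\alpha(n)\Vdash\varphi(n,\bar x)$ for all $n$; $\langle t,\alpha\rangle\Vdash\forall^\infty n\varphi(n,\bar x)$ iff $\alpha(n)\Vdash\varphi(n,\bar x)$ for all $n\ge t$; $\alpha\Vdash\exists^\infty n\varphi(n,\bar x)$ iff for all $n$, writing $\alpha(n)=\langle k,\beta\rangle$, $k\ge n$ and $\beta\Vdash\varphi(k,\bar x)$. Reducibility: $\varphi\le_{\sf m}\psi$ if there are computable functions $\eta,r_-,r_+$ (type-two computable functionals, possibly partial but defined wherever required) such that for every instance $\bar x$: $\varphi(\bar x)$ is true iff $\psi(\eta(\bar x))$ is true; $\alpha\Vdash\varphi(\bar x)$ implies $r_-(\alpha,\bar x)\Vdash\psi(\eta(\bar x))$; $\alpha\Vdash\psi(\eta(\bar x))$ implies $r_+(\alpha,\bar x)\Vdash\varphi(\bar x)$ ($\alpha\in\omega^\omega$ arbitrary). The dual $\varphi^{\sf d}$ of $\mathsf Q_0n_0\dots\mathsf Q_\ell n_\ell\,\theta$ is $\mathsf Q_0^{\sf d}n_0\dots\mathsf Q_\ell^{\sf d}n_\ell\,\neg\theta$, where $\exists^{\sf d}=\forall$, $\forall^{\sf d}=\exists$, $(\exists^\infty)^{\sf d}=\forall^\infty$, $(\forall^\infty)^{\sf d}=\exists^\infty$. $\varphi\le_{\sf dm}\psi$ if $\varphi\le_{\sf m}\psi$ and $\varphi^{\sf d}\le_{\sf m}\psi^{\sf d}$ via a common $\eta$ (the $r_\pm$ may differ). $\varphi$ is strictly $\bar{\mathsf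 Q}$-dicomplete if it is a $\bar{\mathsf Q}$-formula and $\psi\le_{\sf dm}\varphi$ for every $\bar{\mathsf Q}$-formula $\psi$; it is $\bar{\mathsf Q}$-dicomplete if it is $\equiv_{\sf dm}$-equivalent to a strictly $\bar{\mathsf Q}$-dicomplete formula (one such is $\mathsf Q_0n_0\dots\mathsf Q_\ell n_\ell.\ x(n_0,\dots,n_\ell)=0$). Structures: a countable binary relation $(X,R)$, $X\subseteq\omega$, $R\subseteq X^2$, is coded by the pair of characteristic functions of $X$ and $R$, and is identified with its code. For a problem about a class of structures, instances are (computable) codes of structures in the class; reductions from it need only work on such codes and reductions to it must output such codes. Restricted quantifiers $\forall a\in P$, $\exists a\in P$ mean $\forall a(a\in P\to\cdots)$, $\exists a(a\in P\wedge\cdots)$, with these decidable conditions moved into the innermost bounded part; blocks of like quantifiers are contracted by pairing. *)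

(* Defs.v *)
From Stdlib Require Import Arith List.
From Stdlib Require Cantor.
Import ListNotations.

Definition cpair (m n : nat) : nat := Cantor.to_nat (m, n).
Definition cfst (p : nat) : nat := fst (Cantor.of_nat p).
Definition csnd (p : nat) : nat := snd (Cantor.of_nat p).

(** * Computability on natural numbers and on Baire space *)

(** Kleene's partial recursive functions with an oracle, presented as unary
    functions through Cantor pairing; [CMu f] maps [a] to the least [n] with
    [f <a, n> = 0]. *)
Inductive code : Type :=
| CZero | CSucc | CFst | CSnd | COracle
| CPair (f g : code)
| CComp (f g : code)
| CRec (f g : code)
| CMu (f : code).

(** [eval o c n v]: with oracle [o], program [c] halts on [n] with value [v]. *)
Inductive eval (o : nat -> nat) : code -> nat -> nat -> Prop :=
| eval_zero n : eval o CZero n 0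
| eval_succ n : eval o CSucc n (S n)
| eval_fst n : eval o CFst n (cfst n)
| eval_snd n : eval o CSnd n (csnd n)
| eval_oracle n : eval o COracle n (o n)
| eval_pair f g n u v :
    eval o f n u -> eval o g n v -> eval o (CPair f g) n (cpair u v)
| eval_comp f g n u v :
    eval o g n u -> eval o f u v -> eval o (CComp f g) n v
| eval_rec_0 f g a v :
    eval o f a v -> eval o (CRec f g) (cpair a 0) v
| eval_rec_S f g a n u v :
    eval o (CRec f g) (cpair a n) u -> eval o g (cpair a (cpair n u)) v ->
    eval o (CRec f g) (cpair a (S n)) v
| eval_mu f a n (w : nat -> nat) :
    eval o f (cpair a n) 0 ->
    (forall i, i < n -> eval o f (cpair a i) (S (w i))) ->
    eval o (CMu f) a n.

(** [c], read as a partial functional on Baire space, is defined at [x] and has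
    value [y] there. *)
Definition maps (c : code) (x y : nat -> nat) : Prop :=
  forall n, eval x c n (y n).

Definition computable (f : nat -> nat) : Prop :=
  exists c, maps c (fun _ => 0) f.

(** * Identifications with Baire space *)

(** omega x omega^omega: [<t, a>] has head [t] and tail [a]. *)
Definition consf (t : nat) (a : nat -> nat) : nat -> nat :=
  fun m => match m with 0 => t | S m' => a m' end.
Definition tailf (a : nat -> nat) : nat -> nat := fun m => a (S m).

(** (omega^omega)^omega *)
Definition slice (a : nat -> nat) (n : nat) : nat -> nat := fun m => a (cpair n m).

(** (omega^omega)^l for [l = length fs], by interleaving; the empty tuple is
    coded by the zero function. *)
Definition join (fs : list (nat -> nat)) : nat -> nat :=
  fun m => nth (m mod length fs) fs (fun _ => 0) (m / length fs).

(** Tuples of numbers and functions, the numbers being listed first. *)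
Record inst : Type := Inst { nums : list nat; funs : list (nat -> nat) }.

Definition enc (x : inst) : nat -> nat := fold_right consf (join (funs x)) (nums x).

(** The tuple [(n, x)]. *)
Definition push (n : nat) (x : inst) : inst := Inst (n :: nums x) (funs x).

(** * Bounded formulas *)

(** [TVar i] and [TApp j] refer to the [i]-th number and [j]-th function of the
    tuple at hand, so that number variables are de Bruijn indices (0 is the
    innermost quantifier).  Indices out of range denote 0 and the zero function.
    The pairing symbols are a definitional extension of the language of
    arithmetic with function parameters: their graphs are defined by bounded
    formulas and their values have polynomial bounds. *)
Inductive term : Type :=
| TVar (i : nat)
| TZero
| TSucc (t : term)
| TAdd (s t : term)
| TMul (s t : term)
| TPair (s t : term)
| TFst (t : term)
| TSnd (t : term)
| TApp (j : nat) (t : term).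

Inductive bform : Type :=
| BEq (s t : term)
| BLe (s t : term)
| BNot (p : bform)
| BAnd (p q : bform)
| BOr (p q : bform)
| BImp (p q : bform)
| BAll (t : term) (p : bform)
| BEx (t : term) (p : bform).

Fixpoint tval (x : inst) (t : term) : nat :=
  match t with
  | TVar i => nth i (nums x) 0
  | TZero => 0
  | TSucc t => S (tval x t)
  | TAdd s t => tval x s + tval x t
  | TMul s t => tval x s * tval x t
  | TPair s t => cpair (tval x s) (tval x t)
  | TFst t => cfst (tval x t)
  | TSnd t => csnd (tval x t)
  | TApp j t => nth j (funs x) (fun _ => 0) (tval x t)
  end.

Fixpoint bsat (x : inst) (p : bform) : Prop :=
  match p with
  | BEq s t => tval x s = tval x t
  | BLe s t => tval x s <= tval x t
  | BNot p => ~ bsat x p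
  | BAnd p q => bsat x p /\ bsat x q
  | BOr p q => bsat x p \/ bsat x q
  | BImp p q => bsat x p -> bsat x q
  | BAll t p => forall m, m < tval x t -> bsat (push m x) p
  | BEx t p => exists m, m < tval x t /\ bsat (push m x) p
  end.

(** * Quantifier patterns, truth and witnesses *)

Inductive quant : Type := Qex | Qall | QexInf | QallInf.

Definition dualq (Q : quant) : quant :=
  match Q with
  | Qex => Qall | Qall => Qex | QexInf => QallInf | QallInf => QexInf
  end.

Fixpoint holds (Qs : list quant) (th : bform) (x : inst) : Prop :=
  match Qs with
  | [] => bsat x th
  | Qex :: Qs' => exists n, holds Qs' th (push n x)
  | Qall :: Qs' => forall n, holds Qs' th (push n x)
  | QexInf :: Qs' => forall m, exists n, m <= n /\ holds Qs' th (push n x)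
  | QallInf :: Qs' => exists m, forall n, m <= n -> holds Qs' th (push n x)
  end.

Fixpoint wit (Qs : list quant) (th : bform) (x : inst) (a : nat -> nat) : Prop :=
  match Qs with
  | [] => (forall m, a m = enc x m) /\ bsat x th
  | Qex :: Qs' => wit Qs' th (push (a 0) x) (tailf a)
  | Qall :: Qs' => forall n, wit Qs' th (push n x) (slice a n)
  | QexInf :: Qs' =>
      forall n, n <= slice a n 0 /\
        wit Qs' th (push (slice a n 0) x) (tailf (slice a n))
  | QallInf :: Qs' =>
      forall n, a 0 <= n -> wit Qs' th (push n x) (slice (tailf a) n)
  end.

(** A formula with [nnum] number parameters and [nfun] function parameters. *)
Record formula : Type := Formula {
  nnum : nat;
  nfun : nat;
  prefix : list quant;
  matrix : bform
}.

Definition dual (phi : formula) : formula :=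
  Formula (nnum phi) (nfun phi) (map dualq (prefix phi)) (BNot (matrix phi)).

(** A formula about a class of structures: only the instances satisfying [adm]
    are considered. *)
Record problem : Type := Problem { body : formula; adm : inst -> Prop }.

Definition total (phi : formula) : problem := Problem phi (fun _ => True).

Definition dualp (P : problem) : problem := Problem (dual (body P)) (adm P).

Definition instance (P : problem) (x : inst) : Prop :=
  length (nums x) = nnum (body P) /\
  length (funs x) = nfun (body P) /\
  Forall computable (funs x) /\
  adm P x.

Definition holdsp (P : problem) (x : inst) : Prop :=
  holds (prefix (body P)) (matrix (body P)) x.

Definition witp (P : problem) (x : inst) (a : nat -> nat) : Prop :=
  wit (prefix (body P)) (matrix (body P)) x a.

(** * Reducibility and dicompleteness *)

(** The pair [(a, x)] as a point of Baire space. *)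
Definition enc_wit (a : nat -> nat) (x : inst) : nat -> nat := join [a; enc x].

Definition reduces_via (eta : code) (P Q : problem) : Prop :=
  exists rm rp : code, forall x, instance P x ->
    exists y, instance Q y /\ maps eta (enc x) (enc y) /\
      (holdsp P x <-> holdsp Q y) /\
      (forall a, witp P x a ->
         exists b, maps rm (enc_wit a x) b /\ witp Q y b) /\
      (forall a, witp Q y a ->
         exists b, maps rp (enc_wit a x) b /\ witp P x b).

Definition le_m (P Q : problem) : Prop := exists eta, reduces_via eta P Q.

Definition le_dm (P Q : problem) : Prop :=
  exists eta, reduces_via eta P Q /\ reduces_via eta (dualp P) (dualp Q).

Definition equiv_dm (P Q : problem) : Prop := le_dm P Q /\ le_dm Q P.

Definition strictly_dicomplete (Qs : list quant) (phi : formula) : Prop :=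
  prefix phi = Qs /\
  forall psi, prefix psi = Qs -> le_dm (total psi) (total phi).

Definition dicomplete (Qs : list quant) (P : problem) : Prop :=
  exists phi, strictly_dicomplete Qs phi /\ equiv_dm P (total phi).

(** * The lattice problem *)

(** [X] and [R] are the characteristic functions of a set and of a partial
    order on it. *)
Definition codes_poset (X R : nat -> nat) : Prop :=
  (forall n, X n <= 1) /\
  (forall n, R n <= 1) /\
  (forall a b, R (cpair a b) = 1 -> X a = 1 /\ X b = 1) /\
  (forall a, X a = 1 -> R (cpair a a) = 1) /\
  (forall a b, R (cpair a b) = 1 -> R (cpair b a) = 1 -> a = b) /\
  (forall a b c, R (cpair a b) = 1 -> R (cpair b c) = 1 -> R (cpair a c) = 1).

Definition BIn (t : term) : bform := BEq (TApp 0 t) (TSucc TZero).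
Definition BLeP (s t : term) : bform := BEq (TApp 1 (TPair s t)) (TSucc TZero).

(** Under the contracted quantifiers [forall <a,b>, exists <c,d>, forall e]. *)
Definition lattice_matrix : bform :=
  let a := TFst (TVar 2) in
  let b := TSnd (TVar 2) in
  let c := TFst (TVar 1) in
  let d := TSnd (TVar 1) in
  let e := TVar 0 in
  BImp (BAnd (BIn a) (BIn b))
    (BAnd (BAnd (BIn c) (BIn d))
      (BImp (BIn e)
        (BAnd (BAnd (BAnd (BLeP c a) (BLeP c b)) (BAnd (BLeP a d) (BLeP b d)))
          (BAnd
            (BImp (BAnd (BLeP e a) (BLeP e b)) (BLeP e c))
            (BImp (BAnd (BLeP a e) (BLeP b e)) (BLeP d e)))))).

Definition Lattice : problem :=
  Problem (Formula 0 2 [Qall; Qex; Qall] lattice_matrix)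
    (fun x => exists X R, funs x = [X; R] /\ codes_poset X R).

(* Main.v *)
(** The universal formula is [forall n, forall^infinity m, f <n,m> = 0].

    From [Lattice] to it: for a pair [n = <a,b>], guess at stage [m] the least
    [g = <c,d>] not refuted, as infimum and supremum of [a, b], by any [e <= m],
    and ask that the guess eventually stabilises.  As infimum and supremum are
    unique, every wrong guess is refuted by [e = c] or [e = d], where [<c,d>] is
    the right one; hence [<c,d>] itself bounds the stage of stabilisation.
    Conversely, the guess at a stage beyond which nothing changes is right.

    To [Lattice]: put two elements [a_n, b_n] for every [n] between a bottom and
    a top, and below both of them a chain with one new element for each [m] such
    that [f <n,m> <> 0].  The infimum of [a_n, b_n] exists iff the chain is
    finite, and it then bounds those [m].

    The witnesses for the dual formulas carry no information beyond the value of
    the first quantifier: all the others are found by unbounded search. *)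

Require Import Defs.
From Stdlib Require Import List Arith Lia Classical ConstructiveEpsilon
  FunctionalExtensionality.
From Stdlib Require Cantor.
Import ListNotations.

(** * Cantor pairing *)

Arguments cpair : simpl never.
Arguments cfst : simpl never.
Arguments csnd : simpl never.

Lemma cfst_cpair m n : cfst (cpair m n) = m.
Proof. unfold cfst, cpair. now rewrite Cantor.cancel_of_to. Qed.

Lemma csnd_cpair m n : csnd (cpair m n) = n.
Proof. unfold csnd, cpair. now rewrite Cantor.cancel_of_to. Qed.

Lemma cpair_eta n : cpair (cfst n) (csnd n) = n.
Proof.
  unfold cfst, csnd, cpair. rewrite <- surjective_pairing.
  apply Cantor.cancel_to_of.
Qed.

Lemma cpair_eq p q : cfst p = cfst q -> csnd p = csnd q -> p = q.
Proof. intros H1 H2. rewrite <- (cpair_eta p), <- (cpair_eta q). congruence. Qed.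

Lemma cpair_ge m n : m + n <= cpair m n.
Proof. pose proof (Cantor.to_nat_non_decreasing m n). unfold cpair. lia. Qed.

(** The code of a pair is [n] plus the triangular number of [m + n], and both summands are
    monotone. *)
Lemma cpair_mono m n m' n' : m <= m' -> n <= n' -> cpair m n <= cpair m' n'.
Proof.
  intros H1 H2. unfold cpair, Cantor.to_nat.
  assert (H : m + n <= m' + n') by lia.
  apply Nat.add_le_mono; [assumption|].
  rewrite (Nat.add_comm n m), (Nat.add_comm n' m').
  generalize dependent (m' + n'). induction 1 as [|k _ IH]; cbn;
    [reflexivity | apply le_S; etransitivity; [apply IH | apply Nat.le_add_l]].
Qed.

Lemma csnd_0 : csnd 0 = 0.
Proof. reflexivity. Qed.

(** * Codes *)

Lemma eval_eq o c n v w : eval o c n v -> v = w -> eval o c n w.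
Proof. now intros H []. Qed.

Definition cid : code := CPair CFst CSnd.

Lemma eval_id o n : eval o cid n n.
Proof. eapply eval_eq; [repeat constructor | apply cpair_eta]. Qed.

(** Substituting [d] for the oracle composes functionals on Baire space. *)
Fixpoint osub (d c : code) : code :=
  match c with
  | COracle => d
  | CPair f g => CPair (osub d f) (osub d g)
  | CComp f g => CComp (osub d f) (osub d g)
  | CRec f g => CRec (osub d f) (osub d g)
  | CMu f => CMu (osub d f)
  | c => c
  end.

Lemma eval_osub o o' d c n v :
  maps d o o' -> eval o' c n v -> eval o (osub d c) n v.
Proof.
  intros Hd H. induction H; cbn; try (econstructor; eassumption).
  apply Hd.
Qed.

Lemma maps_osub o o' d c f : maps d o o' -> maps c o' f -> maps (osub d c) o f.
Proof. intros Hd Hc n. eapply eval_osub; eauto. Qed.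

(** Case distinction on the value of [r]: [f] receives the input, [g] the pair
    of the input and the predecessor. *)
Definition ccase (r f g : code) : code :=
  CComp (CRec f (CComp g (CPair CFst (CComp CFst CSnd)))) (CPair cid r).

(** A single function [V] holds the values of both branches. All branches must be defined, because
    the underlying recursion passes through every smaller value. *)
Lemma eval_case o r f g n k (V : nat -> nat) :
  eval o r n k -> eval o f n (V 0) ->
  (forall i, eval o g (cpair n i) (V (S i))) ->
  eval o (ccase r f g) n (V k).
Proof.
  intros Hr Hf Hg. unfold ccase.
  econstructor; [constructor; [apply eval_id | exact Hr]|].
  clear Hr. induction k.
  - now constructor.
  - econstructor; [exact IHk|].
    econstructor; [|apply Hg].
    eapply eval_eq; [repeat econstructor|].
    now rewrite !cfst_cpair, csnd_cpair, cfst_cpair.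
Qed.

Definition cadd : code := CRec cid (CComp CSucc (CComp CSnd CSnd)).
Definition cmul : code := CRec CZero (CComp cadd (CPair (CComp CSnd CSnd) CFst)).
Definition cpred : code := ccase cid CZero CSnd.
Definition csub : code := CRec cid (CComp cpred (CComp CSnd CSnd)).

Ltac csimp := rewrite ?cfst_cpair, ?csnd_cpair.

Ltac ev := eapply eval_eq; [repeat econstructor | repeat csimp; reflexivity].

Lemma eval_add o a n : eval o cadd (cpair a n) (a + n).
Proof.
  induction n.
  - constructor. eapply eval_eq; [apply eval_id | lia].
  - econstructor; [eassumption|]. eapply eval_eq; [repeat econstructor|].
    repeat csimp. lia.
Qed.

Lemma eval_mul o a n : eval o cmul (cpair a n) (a * n).
Proof.
  induction n.
  - constructor. eapply eval_eq; [constructor | lia].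
  - econstructor; [eassumption|].
    eapply eval_eq; [econstructor; [repeat econstructor | apply eval_add]|].
    repeat csimp. lia.
Qed.

Lemma eval_pred o n : eval o cpred n (pred n).
Proof.
  apply (eval_case _ _ _ _ _ _ pred); [apply eval_id | constructor|].
  intros i. eapply eval_eq; [constructor | now csimp].
Qed.

Lemma eval_sub o a n : eval o csub (cpair a n) (a - n).
Proof.
  induction n.
  - constructor. eapply eval_eq; [apply eval_id | lia].
  - econstructor; [eassumption|].
    eapply eval_eq; [econstructor; [repeat econstructor | apply eval_pred]|].
    repeat csimp. lia.
Qed.

Fixpoint numc (n : nat) : code :=
  match n with 0 => CZero | S n => CComp CSucc (numc n) end.

Lemma eval_num o k n : eval o (numc k) n k.
Proof. induction k; cbn; econstructor; [eassumption | constructor]. Qed.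

(** * Compilation of bounded formulas *)

Definition envc (ns : list nat) : nat := fold_right cpair 0 ns.

Definition envcode (es : list code) : code := fold_right CPair CZero es.

Lemma eval_env o es ns n :
  Forall2 (fun c v => eval o c n v) es ns -> eval o (envcode es) n (envc ns).
Proof. induction 1; cbn; now constructor. Qed.

Fixpoint varc (i : nat) : code :=
  match i with 0 => CFst | S i => CComp (varc i) CSnd end.

(** Out of range the lookup stays at 0, since 0 codes the pair of 0 and 0; this agrees with the
    default of [nth]. *)
Lemma eval_var o i ns : eval o (varc i) (envc ns) (nth i ns 0).
Proof.
  revert ns. induction i; intros [|k ns]; cbn.
  - eapply eval_eq; [constructor | reflexivity].
  - eapply eval_eq; [constructor | apply cfst_cpair].
  - econstructor; [constructor|]. rewrite csnd_0. specialize (IHi []).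
    now destruct i.
  - econstructor; [constructor|].
    change (envc (k :: ns)) with (cpair k (envc ns)).
    rewrite csnd_cpair. apply IHi.
Qed.

(** The codes [cs] compute the functions that [TApp] refers to. *)
Fixpoint tcode (cs : list code) (t : term) : code :=
  match t with
  | TVar i => varc i
  | TZero => CZero
  | TSucc t => CComp CSucc (tcode cs t)
  | TAdd s t => CComp cadd (CPair (tcode cs s) (tcode cs t))
  | TMul s t => CComp cmul (CPair (tcode cs s) (tcode cs t))
  | TPair s t => CPair (tcode cs s) (tcode cs t)
  | TFst t => CComp CFst (tcode cs t)
  | TSnd t => CComp CSnd (tcode cs t)
  | TApp j t => CComp (nth j cs CZero) (tcode cs t)
  end.

Definition maps_all (o : nat -> nat) (cs : list code) (gs : list (nat -> nat)) :=
  Forall2 (fun c g => maps c o g) cs gs.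

Lemma maps_nth o cs gs j :
  maps_all o cs gs -> maps (nth j cs CZero) o (nth j gs (fun _ => 0)).
Proof.
  intros H. revert j. induction H; intros [|j]; cbn; auto; intros n; constructor.
Qed.

Lemma eval_tcode o cs ns gs t :
  maps_all o cs gs -> eval o (tcode cs t) (envc ns) (tval (Inst ns gs) t).
Proof.
  intros Hcs. induction t; cbn; try (econstructor; solve [eauto | constructor]).
  - apply eval_var.
  - econstructor; [constructor; eassumption | apply eval_add].
  - econstructor; [constructor; eassumption | apply eval_mul].
  - econstructor; [eassumption | now apply maps_nth].
Qed.

(** The value is [0] when the formula is true. *)
Fixpoint bval (x : inst) (p : bform) : nat :=
  match p with
  | BEq s t => (tval x s - tval x t) + (tval x t - tval x s)
  | BLe s t => tval x s - tval x t
  | BNot p => 1 - bval x p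
  | BAnd p q => bval x p + bval x q
  | BOr p q => bval x p * bval x q
  | BImp p q => (1 - bval x p) * bval x q
  | BAll t p => nat_rect _ 0 (fun m u => u + bval (push m x) p) (tval x t)
  | BEx t p => nat_rect _ 1 (fun m u => u * bval (push m x) p) (tval x t)
  end.

(** A sum of naturals vanishes iff all terms do, a product iff some factor does. *)
Lemma bval_bsat p : forall x, bval x p = 0 <-> bsat x p.
Proof.
  induction p; intros x; cbn [bval bsat];
    try (rewrite <- IHp); try (rewrite <- IHp1, <- IHp2); rewrite ?Nat.eq_mul_0;
    try lia.
  - induction (tval x t) as [|k IH]; cbn; [split; [intros; lia | reflexivity]|].
    rewrite Nat.eq_add_0, IH, IHp. split.
    + intros [H1 H2] m Hm.
      destruct (Nat.eq_dec m k) as [->|]; [assumption | apply H1; lia].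
    + intros H. split; [intros m Hm|]; apply H; lia.
  - induction (tval x t) as [|k IH]; cbn.
    + split; [discriminate | intros (m & Hm & _); lia].
    + rewrite Nat.eq_mul_0, IH, IHp. split.
      * intros [(m & Hm & H) | H]; [exists m | exists k]; split; auto with arith.
      * intros (m & Hm & H). destruct (Nat.eq_dec m k) as [->|]; [now right|].
        left. exists m. split; [lia | assumption].
Qed.

(** Bounded quantifiers become recursions on the bound with the environment as parameter; the body
    is run on [<m, env>]. *)
Fixpoint bcode (cs : list code) (p : bform) : code :=
  match p with
  | BEq s t =>
      CComp cadd (CPair (CComp csub (CPair (tcode cs s) (tcode cs t)))
                        (CComp csub (CPair (tcode cs t) (tcode cs s))))
  | BLe s t => CComp csub (CPair (tcode cs s) (tcode cs t))
  | BNot p => CComp csub (CPair (numc 1) (bcode cs p))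
  | BAnd p q => CComp cadd (CPair (bcode cs p) (bcode cs q))
  | BOr p q => CComp cmul (CPair (bcode cs p) (bcode cs q))
  | BImp p q =>
      CComp cmul (CPair (CComp csub (CPair (numc 1) (bcode cs p))) (bcode cs q))
  | BAll t p =>
      CComp (CRec CZero (CComp cadd (CPair (CComp CSnd CSnd)
              (CComp (bcode cs p) (CPair (CComp CFst CSnd) CFst)))))
            (CPair cid (tcode cs t))
  | BEx t p =>
      CComp (CRec (numc 1) (CComp cmul (CPair (CComp CSnd CSnd)
              (CComp (bcode cs p) (CPair (CComp CFst CSnd) CFst)))))
            (CPair cid (tcode cs t))
  end.

Lemma eval_bcode o cs gs p :
  maps_all o cs gs ->
  forall ns, eval o (bcode cs p) (envc ns) (bval (Inst ns gs) p).
Proof.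
  intros Hcs.
  assert (Ht : forall t ns, eval o (tcode cs t) (envc ns) (tval (Inst ns gs) t))
    by (intros; now apply eval_tcode).
  induction p; intros ns; cbn [bcode bval].
  - econstructor; [|apply eval_add]. constructor;
      (econstructor; [constructor; apply Ht | apply eval_sub]).
  - econstructor; [constructor; apply Ht | apply eval_sub].
  - econstructor; [constructor; [apply eval_num | apply IHp] | apply eval_sub].
  - econstructor; [constructor; [apply IHp1 | apply IHp2] | apply eval_add].
  - econstructor; [constructor; [apply IHp1 | apply IHp2] | apply eval_mul].
  - econstructor; [constructor; [|apply IHp2] | apply eval_mul].
    econstructor; [constructor; [apply eval_num | apply IHp1] | apply eval_sub].
  - econstructor; [constructor; [apply eval_id | apply Ht]|].
    induction (tval (Inst ns gs) t) as [|k IH]; cbn; [repeat constructor|].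
    econstructor; [exact IH|].
    econstructor; [constructor|apply eval_add].
    + eapply eval_eq; [repeat econstructor | now repeat csimp].
    + econstructor; [|apply (IHp (k :: ns))].
      eapply eval_eq; [repeat econstructor | now repeat csimp].
  - econstructor; [constructor; [apply eval_id | apply Ht]|].
    induction (tval (Inst ns gs) t) as [|k IH]; cbn;
      [constructor; apply (eval_num _ 1)|].
    econstructor; [exact IH|].
    econstructor; [constructor|apply eval_mul].
    + eapply eval_eq; [repeat econstructor | now repeat csimp].
    + econstructor; [|apply (IHp (k :: ns))].
      eapply eval_eq; [repeat econstructor | now repeat csimp].
Qed.

(** * Deciding bounded formulas and searching for their solutions *)

(** The codes [es] compute the number variables of [p] from the input, the codes [cs] its function
    parameters from the oracle. *)
Definition test (cs es : list code) (p : bform) : code :=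
  CComp (bcode cs p) (envcode es).

Lemma eval_test o cs gs es ns p n :
  maps_all o cs gs -> Forall2 (fun c v => eval o c n v) es ns ->
  eval o (test cs es p) n (bval (Inst ns gs) p).
Proof.
  intros Hcs Hes. unfold test.
  econstructor; [exact (eval_env _ _ _ _ Hes) | now apply eval_bcode].
Qed.

Definition search (cs es : list code) (p : bform) : code := CMu (test cs es p).

Lemma eval_search o cs gs es (ns : nat -> list nat) p n v :
  maps_all o cs gs ->
  (forall i, Forall2 (fun c w => eval o c (cpair n i) w) es (ns i)) ->
  bsat (Inst (ns v) gs) p ->
  (forall i, bsat (Inst (ns i) gs) p -> v <= i) ->
  eval o (search cs es p) n v.
Proof.
  intros Hcs Hes Hv Hmin.
  apply eval_mu with (w := fun i => pred (bval (Inst (ns i) gs) p)).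
  - eapply eval_eq; [exact (eval_test _ _ _ _ _ _ _ Hcs (Hes v))|].
    now apply bval_bsat.
  - intros i Hi. eapply eval_eq; [exact (eval_test _ _ _ _ _ _ _ Hcs (Hes i))|].
    destruct (bval (Inst (ns i) gs) p) eqn:E; [|reflexivity].
    apply bval_bsat in E. apply Hmin in E. lia.
Qed.

(** Bounded formulas are decidable, so mere existence of solutions yields the least one as a
    function of the input. *)
Lemma search_maps o cs gs es (ns : nat -> nat -> list nat) p :
  maps_all o cs gs ->
  (forall n i, Forall2 (fun c w => eval o c (cpair n i) w) es (ns n i)) ->
  (forall n, exists i, bsat (Inst (ns n i) gs) p) ->
  exists h, maps (search cs es p) o h /\
    forall n, bsat (Inst (ns n (h n)) gs) p /\
      forall i, bsat (Inst (ns n i) gs) p -> h n <= i.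
Proof.
  intros Hcs Hes Hex.
  assert (Hdec : forall n i,
            {bsat (Inst (ns n i) gs) p} + {~ bsat (Inst (ns n i) gs) p}).
  { intros n i. destruct (Nat.eq_dec (bval (Inst (ns n i) gs) p) 0) as [E|E];
      rewrite bval_bsat in E; auto. }
  exists (fun n => proj1_sig (epsilon_smallest _ (Hdec n) (Hex n))).
  assert (H : forall n, let h := proj1_sig (epsilon_smallest _ (Hdec n) (Hex n)) in
            bsat (Inst (ns n h) gs) p /\
            forall i, bsat (Inst (ns n i) gs) p -> h <= i).
  { intros n. cbv zeta. destruct (epsilon_smallest _ _ _) as (v & Hv & Hmin). auto. }
  split; [|exact H].
  intros n. destruct (H n) as [Hv Hmin].
  eapply eval_search; eauto.
Qed.

(** * Tuples *)

Lemma Forall2_map_seq {A B} (P : A -> B -> Prop) (f : nat -> A) (l : list B) d :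
  (forall j, j < length l -> P (f j) (nth j l d)) ->
  Forall2 P (map f (seq 0 (length l))) l.
Proof.
  revert f. induction l as [|b l IH]; intros f H; cbn; constructor.
  - apply (H 0). cbn. lia.
  - rewrite <- seq_shift, map_map. apply IH. intros j Hj.
    apply (H (S j)). cbn. lia.
Qed.

Fixpoint num (n : nat) : term :=
  match n with 0 => TZero | S n => TSucc (num n) end.

Lemma tval_num x n : tval x (num n) = n.
Proof. induction n; cbn; congruence. Qed.

Lemma join_nth fs q j :
  j < length fs -> join fs (q * length fs + j) = nth j fs (fun _ => 0) q.
Proof.
  intros Hj. unfold join.
  rewrite Nat.add_comm, Nat.Div0.mod_add, Nat.mod_small, Nat.div_add,
    Nat.div_small by lia. reflexivity.
Qed.

Lemma join_1 f : join [f] = f.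
Proof.
  extensionality q. pose proof (join_nth [f] q 0) as H.
  cbn [length nth] in H. rewrite Nat.mul_1_r, Nat.add_0_r in H. apply H. lia.
Qed.

(** The graph of [join], with the argument as variable 0 and the value as variable 1: the bound
    variable is the quotient by [l], and the disjunction runs over the remainders. *)
Definition join_graph (l : nat) : bform :=
  BEx (TSucc (TVar 0))
    (fold_right BOr (BNot (BEq TZero TZero))
      (map (fun j => BAnd (BEq (TVar 1) (TAdd (TMul (TVar 0) (num l)) (num j)))
                          (BEq (TVar 2) (TApp j (TVar 0)))) (seq 0 l))).

Lemma bsat_bors x ps :
  bsat x (fold_right BOr (BNot (BEq TZero TZero)) ps) <->
  exists p, In p ps /\ bsat x p.
Proof.
  induction ps as [|p ps IH]; cbn.
  - split; [now intros [] | now intros (p & [] & _)].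
  - rewrite IH. split.
    + intros [H|(p' & Hp & H)]; eauto.
    + intros (p' & [->|Hp] & H); eauto.
Qed.

Lemma bsat_join_graph gs m v :
  gs <> [] -> bsat (Inst [m; v] gs) (join_graph (length gs)) <-> v = join gs m.
Proof.
  intros Hgs.
  assert (Hl : length gs <> 0) by now destruct gs.
  unfold join_graph. cbn [bsat tval nums nth]. split.
  - intros (q & _ & H). apply bsat_bors in H as (p & Hp & H).
    apply in_map_iff in Hp as (j & <- & Hj). apply in_seq in Hj.
    cbn in H. rewrite !tval_num in H. destruct H as [-> ->].
    rewrite join_nth; [reflexivity | lia].
  - intros ->. exists (m / length gs). split.
    + apply Nat.lt_succ_r, Nat.Div0.div_le_upper_bound; nia.
    + apply bsat_bors. eexists. split.
      * apply in_map_iff. exists (m mod length gs). split; [reflexivity|].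
        apply in_seq. pose proof (Nat.mod_upper_bound m (length gs) Hl). lia.
      * cbn. rewrite !tval_num. split; [|reflexivity].
        pose proof (Nat.div_mod_eq m (length gs)). lia.
Qed.

(** Searching the graph for the value avoids programming division. *)
Definition joinc (cs : list code) : code :=
  match cs with
  | [] => CZero
  | _ => search cs [CFst; CSnd] (join_graph (length cs))
  end.

Lemma maps_joinc o cs gs : maps_all o cs gs -> maps (joinc cs) o (join gs).
Proof.
  intros H m. destruct H as [|c g cs gs Hc Hcs].
  - eapply eval_eq; [constructor|]. unfold join. now destruct (m mod _).
  - unfold joinc. replace (length (c :: cs)) with (length (g :: gs))
      by (cbn; f_equal; symmetry; exact (Forall2_length Hcs)).
    apply eval_search with (gs := g :: gs) (ns := fun i => [m; i]).
    + now constructor.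
    + intros i. repeat constructor; (eapply eval_eq; [constructor | now csimp]).
    + now apply bsat_join_graph.
    + intros i Hi. apply bsat_join_graph in Hi; [now subst | discriminate].
Qed.

(** * Reading the components of a tuple off its code *)

Definition numcodes (k : nat) : list code :=
  map (fun i => CComp COracle (numc i)) (seq 0 k).

(** After [k] numbers, the value at [q] of the [j]-th of [l] interleaved functions stands at
    position [k + (q * l + j)]. *)
Definition funcode (k l j : nat) : code :=
  CComp COracle (CComp cadd (CPair (numc k)
    (CComp cadd (CPair (CComp cmul (CPair cid (numc l))) (numc j))))).

Definition funcodes (k l : nat) : list code := map (funcode k l) (seq 0 l).

Lemma enc_num x i : i < length (nums x) -> enc x i = nth i (nums x) 0.
Proof.
  destruct x as [ns fs]. unfold enc. cbn. revert i.
  induction ns as [|k ns IH]; intros [|i] Hi; cbn in *; try lia.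
  apply IH. lia.
Qed.

Lemma enc_fun x m : enc x (length (nums x) + m) = join (funs x) m.
Proof.
  destruct x as [ns fs]. unfold enc. cbn. now induction ns.
Qed.

Lemma eval_numcodes x n :
  Forall2 (fun c v => eval (enc x) c n v) (numcodes (length (nums x))) (nums x).
Proof.
  apply Forall2_map_seq with (d := 0). intros j Hj.
  eapply eval_eq; [econstructor; [apply eval_num | constructor]|].
  now apply enc_num.
Qed.

Lemma maps_funcodes x :
  maps_all (enc x) (funcodes (length (nums x)) (length (funs x))) (funs x).
Proof.
  apply Forall2_map_seq with (d := fun _ => 0). intros j Hj q.
  eapply eval_eq.
  - econstructor; [|constructor].
    econstructor; [|apply eval_add].
    constructor; [apply eval_num|].
    econstructor; [|apply eval_add].
    constructor; [|apply eval_num].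
    econstructor; [|apply eval_mul].
    constructor; [apply eval_id | apply eval_num].
  - now rewrite enc_fun, join_nth.
Qed.

(** Instances produced by a reduction must be computable; they are computed from the code of the
    given instance. *)
Lemma computable_enc x : Forall computable (funs x) -> computable (enc x).
Proof.
  destruct x as [ns fs]. unfold enc. cbn. intros H.
  induction ns as [|k ns [c IH]]; cbn.
  - assert (Hcs : exists cs, maps_all (fun _ => 0) cs fs).
    { induction H as [|f fs [c Hc] _ [cs Hcs]].
      - exists []. constructor.
      - exists (c :: cs). now constructor. }
    destruct Hcs as [cs Hcs]. exists (joinc cs). now apply maps_joinc.
  - exists (ccase cid (numc k) (CComp c CSnd)). intros m.
    apply (eval_case _ _ _ _ _ _ (consf k (fold_right consf (join fs) ns))).
    + apply eval_id.
    + apply eval_num.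
    + intros i. econstructor; [constructor|]. rewrite csnd_cpair. apply IH.
Qed.

Definition cwit : code := funcode 0 2 0.
Definition cinst : code := funcode 0 2 1.

Lemma maps_cwit a x : maps cwit (enc_wit a x) a.
Proof. pose proof (maps_funcodes (Inst [] [a; enc x])) as H. now inversion H. Qed.

Lemma maps_cinst a x : maps cinst (enc_wit a x) (enc x).
Proof.
  pose proof (maps_funcodes (Inst [] [a; enc x])) as H.
  inversion H as [|? ? ? ? _ H']. now inversion H'.
Qed.

Lemma maps_enc_wit o c d a x :
  maps c o a -> maps d o (enc x) -> maps (joinc [c; d]) o (enc_wit a x).
Proof. intros Hc Hd. apply maps_joinc. now repeat constructor. Qed.

(** * Witnesses from Skolem functions *)

(** [hs] lists the choices to be made along the prefix; each choice depends on
    the list [ls] of the values of the previous quantifiers, the innermost one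
    first. *)
Fixpoint skolem (Qs : list quant) (th : bform) (hs : list (nat -> nat))
    (ls : list nat) (x : inst) : Prop :=
  let h := hd (fun _ => 0) hs in
  match Qs with
  | [] => bsat x th
  | Qex :: Qs =>
      let n := h (envc ls) in skolem Qs th (tl hs) (n :: ls) (push n x)
  | Qall :: Qs => forall n, skolem Qs th hs (n :: ls) (push n x)
  | QexInf :: Qs =>
      forall n, let k := h (cpair n (envc ls)) in
        n <= k /\ skolem Qs th (tl hs) (k :: ls) (push k x)
  | QallInf :: Qs =>
      forall n, h (envc ls) <= n -> skolem Qs th (tl hs) (n :: ls) (push n x)
  end.

(** The witness determined by the choices [hs]. Below the prefix it must be the instance extended by
    the quantified values [ls], where [f] is the code of the original instance. *)
Fixpoint wfun (Qs : list quant) (hs : list (nat -> nat)) (f : nat -> nat)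
    (ls : list nat) (k : nat) : nat :=
  let h := hd (fun _ => 0) hs in
  match Qs with
  | [] => fold_right consf f ls k
  | Qex :: Qs =>
      let n := h (envc ls) in
      match k with 0 => n | S i => wfun Qs (tl hs) f (n :: ls) i end
  | Qall :: Qs => wfun Qs hs f (cfst k :: ls) (csnd k)
  | QexInf :: Qs =>
      let n := h (cpair (cfst k) (envc ls)) in
      match csnd k with 0 => n | S i => wfun Qs (tl hs) f (n :: ls) i end
  | QallInf :: Qs =>
      match k with
      | 0 => h (envc ls)
      | S i => wfun Qs (tl hs) f (cfst i :: ls) (csnd i)
      end
  end.

Lemma wfun_wit Qs th f : forall hs ls x,
  skolem Qs th hs ls x -> fold_right consf f ls = enc x ->
  wit Qs th x (wfun Qs hs f ls).
Proof.
  assert (Hpush : forall n ls x, fold_right consf f ls = enc x ->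
            fold_right consf f (n :: ls) = enc (push n x))
    by (intros n ls x H; cbn; now rewrite H).
  induction Qs as [|[] Qs IH]; intros hs ls x H Hx; cbn [skolem wit wfun] in H |- *.
  - split; [intros m; now rewrite Hx | assumption].
  - apply IH; auto.
  - intros n.
    replace (slice _ n) with (wfun Qs hs f (n :: ls)); [now apply IH; auto|].
    extensionality m. unfold slice. now csimp.
  - intros n. destruct (H n) as [Hn H'].
    replace (slice _ n) with (consf (hd (fun _ => 0) hs (cpair n (envc ls)))
      (wfun Qs (tl hs) f (hd (fun _ => 0) hs (cpair n (envc ls)) :: ls))).
    + cbn. split; [assumption|]. apply IH; auto.
    + extensionality m. unfold slice. now csimp.
  - intros n Hn.
    replace (slice _ n) with (wfun Qs (tl hs) f (n :: ls)); [now apply IH; auto|].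
    extensionality m. unfold slice, tailf. now csimp.
Qed.

(** The length [d] of the list is supplied separately, as its code does not determine it: 0 codes
    both [[]] and [[0]]. *)
Fixpoint leafc (c : code) (d : nat) : code :=
  match d with
  | 0 => CComp c CSnd
  | S d =>
      ccase CSnd (CComp CFst CFst)
        (CComp (leafc c d) (CPair (CComp CSnd (CComp CFst CFst)) CSnd))
  end.

(** The input is [<envc ls, k>]; in the successor branches of [ccase] it is [<<envc ls, k>, i>]. *)
Fixpoint wcode (Qs : list quant) (hcs : list code) (c : code) (d : nat) : code :=
  let h := hd CZero hcs in
  match Qs with
  | [] => leafc c d
  | Qex :: Qs =>
      ccase CSnd (CComp h CFst)
        (CComp (wcode Qs (tl hcs) c (S d))
          (CPair (CPair (CComp h (CComp CFst CFst)) (CComp CFst CFst)) CSnd))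
  | Qall :: Qs =>
      CComp (wcode Qs hcs c (S d))
        (CPair (CPair (CComp CFst CSnd) CFst) (CComp CSnd CSnd))
  | QexInf :: Qs =>
      ccase (CComp CSnd CSnd) (CComp h (CPair (CComp CFst CSnd) CFst))
        (CComp (wcode Qs (tl hcs) c (S d))
          (CPair (CPair (CComp (CComp h (CPair (CComp CFst CSnd) CFst)) CFst)
                        (CComp CFst CFst)) CSnd))
  | QallInf :: Qs =>
      ccase CSnd (CComp h CFst)
        (CComp (wcode Qs (tl hcs) c (S d))
          (CPair (CPair (CComp CFst CSnd) (CComp CFst CFst)) (CComp CSnd CSnd)))
  end.

Lemma eval_leafc o c f ls k :
  maps c o f ->
  eval o (leafc c (length ls)) (cpair (envc ls) k) (fold_right consf f ls k).
Proof.
  intros Hc. revert k. induction ls as [|n ls IH]; intros k; cbn.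
  - econstructor; [ev | apply Hc].
  - apply (eval_case _ _ _ _ _ _ (consf n (fold_right consf f ls))); [ev | ev|].
    intros i. econstructor; [ev | apply IH].
Qed.

Lemma eval_wcode o Qs c f : maps c o f -> forall hcs hs ls k,
  maps_all o hcs hs ->
  eval o (wcode Qs hcs c (length ls)) (cpair (envc ls) k) (wfun Qs hs f ls k).
Proof.
  intros Hc. induction Qs as [|Q Qs IH]; intros hcs hs ls k Hhs.
  - now apply eval_leafc.
  - assert (Hh : maps (hd CZero hcs) o (hd (fun _ => 0) hs))
      by (destruct Hhs; [intros n; constructor | assumption]).
    assert (Htl : maps_all o (tl hcs) (tl hs))
      by (destruct Hhs; [constructor | assumption]).
    set (h := hd (fun _ => 0) hs) in *.
    destruct Q; cbn [wcode wfun]; fold h.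
    + apply (eval_case _ _ _ _ _ _ (fun k => match k with 0 => _ | S i => _ end));
        [ev | econstructor; [constructor | csimp; apply Hh]|].
      intros i. econstructor; [|apply (IH _ _ (h (envc ls) :: ls)), Htl].
      constructor; [constructor|].
      * econstructor; [repeat econstructor|]. repeat csimp. apply Hh.
      * ev.
      * ev.
    + econstructor; [|apply (IH _ _ (cfst k :: ls)), Hhs]. ev.
    + apply (eval_case _ _ _ _ _ _ (fun k => match k with 0 => _ | S i => _ end));
        [ev | |].
      * econstructor; [ev | apply Hh].
      * intros i.
        econstructor; [|apply (IH _ _ (h (cpair (cfst k) (envc ls)) :: ls)), Htl].
        constructor; [constructor|].
        -- econstructor; [repeat econstructor|]. econstructor; [ev | apply Hh].
        -- ev.
        -- ev.
    + apply (eval_case _ _ _ _ _ _ (fun k => match k with 0 => _ | S i => _ end));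
        [ev | econstructor; [constructor | csimp; apply Hh]|].
      intros i. econstructor; [|apply (IH _ _ (cfst i :: ls)), Htl]. ev.
Qed.

Definition skolem_code (Qs : list quant) (hcs : list code) (c : code) : code :=
  CComp (wcode Qs hcs c 0) (CPair CZero cid).

(** Computing a witness thus reduces to computing Skolem functions. *)
Lemma skolem_wit o Qs th hcs hs c x :
  maps_all o hcs hs -> maps c o (enc x) -> skolem Qs th hs [] x ->
  exists b, maps (skolem_code Qs hcs c) o b /\ wit Qs th x b.
Proof.
  intros Hhs Hc H. exists (wfun Qs hs (enc x) []). split.
  - intros k. econstructor; [constructor; [constructor | apply eval_id]|].
    now apply (eval_wcode _ Qs c (enc x) Hc hcs hs []).
  - now apply wfun_wit.
Qed.

(** * Reductions between problems of [forall forall^infinity] type *)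

Lemma holds_dual Qs th : forall x,
  holds (map dualq Qs) (BNot th) x <-> ~ holds Qs th x.
Proof.
  induction Qs as [|[] Qs IH]; intros x; cbn.
  - reflexivity.
  - setoid_rewrite IH. firstorder.
  - setoid_rewrite IH. split; [firstorder|]. apply not_all_ex_not.
  - setoid_rewrite IH. split.
    + intros (m & Hm) H. destruct (H m) as (n & Hn & H'). now apply (Hm n).
    + intros H. apply not_all_ex_not in H as (m & Hm). exists m. firstorder.
  - setoid_rewrite IH. split.
    + intros H (m & Hm). destruct (H m) as (n & Hn & H'). auto.
    + intros H m. apply NNPP. intros H'. apply H. exists m. intros n Hn.
      apply NNPP. firstorder.
Qed.

Lemma holdsp_dual P x : holdsp (dualp P) x <-> ~ holdsp P x.
Proof. apply holds_dual. Qed.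

(** The functions in [A x] carry the same information as the witnesses at [x]. *)
Definition converts (P : problem) (A : inst -> (nat -> nat) -> Prop) : Prop :=
  (exists u, forall x a, instance P x -> witp P x a ->
     exists t, maps u (enc_wit a x) t /\ A x t) /\
  (exists v, forall x t, instance P x -> A x t ->
     exists b, maps v (enc_wit t x) b /\ witp P x b).

(** A witness is turned into information [t] about one instance, which is equally information about
    the other, and then back into a witness; [eta] supplies the code of [y]. *)
Lemma converts_reduces P Q A B eta :
  converts P A -> converts Q B ->
  (forall x, instance P x -> exists y, instance Q y /\ maps eta (enc x) (enc y) /\
     (holdsp P x <-> holdsp Q y) /\ forall t, A x t <-> B y t) ->
  reduces_via eta P Q.
Proof.
  intros [[uP HuP] [vP HvP]] [[uQ HuQ] [vQ HvQ]] H.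
  exists (osub (joinc [uP; osub cinst eta]) vQ).
  exists (osub (joinc [osub (joinc [cwit; osub cinst eta]) uQ; cinst]) vP).
  intros x Hx. destruct (H x Hx) as (y & Hy & Heta & Hh & HAB).
  assert (Hetaw : forall a, maps (osub cinst eta) (enc_wit a x) (enc y))
    by (intros a; eapply maps_osub; [apply maps_cinst | exact Heta]).
  exists y. repeat split; try apply Hh; try apply Hy; [exact Heta| |].
  - intros a Ha. destruct (HuP x a Hx Ha) as (t & Ht & HA).
    apply HAB in HA. destruct (HvQ y t Hy HA) as (b & Hb & Hw).
    exists b. split; [|exact Hw]. eapply maps_osub; [|exact Hb].
    now apply maps_enc_wit.
  - intros a Ha. destruct (HuQ y a Hy Ha) as (t & Ht & HA).
    apply HAB in HA. destruct (HvP x t Hx HA) as (b & Hb & Hw).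
    exists b. split; [|exact Hw]. eapply maps_osub; [|exact Hb].
    apply maps_enc_wit; [|apply maps_cinst].
    eapply maps_osub; [|exact Ht]. apply maps_enc_wit; [apply maps_cwit | auto].
Qed.

Definition bounds (F : nat -> nat -> Prop) (t : nat -> nat) : Prop :=
  forall n m, t n <= m -> F n m.

Definition recurs (F : nat -> nat -> Prop) (p : nat) : Prop :=
  forall n, exists m, n <= m /\ ~ F p m.

(** [P x] amounts to [forall n, forall^infinity m, F x n m]. *)
Definition presents (P : problem) (F : inst -> nat -> nat -> Prop) : Prop :=
  (forall x, instance P x ->
     (holdsp P x <-> forall n, exists k, forall m, k <= m -> F x n m)) /\
  converts P (fun x => bounds (F x)) /\
  converts (dualp P) (fun x t => exists p, t = (fun _ => p) /\ recurs (F x) p).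

(** Moduli and refuting rows depend only on the relation, so a map of instances preserving it serves
    the formulas and their duals at once. *)
Lemma presents_le_dm P Q F G eta :
  presents P F -> presents Q G ->
  (forall x, instance P x -> exists y, instance Q y /\ maps eta (enc x) (enc y) /\
     forall n m, F x n m <-> G y n m) ->
  le_dm P Q.
Proof.
  intros (HP & CP & DP) (HQ & CQ & DQ) H. exists eta.
  split; eapply converts_reduces; eauto; intros x Hx;
    destruct (H x Hx) as (y & Hy & Heta & HFG); exists y;
    (split; [exact Hy|]); (split; [exact Heta|]);
    rewrite ?holdsp_dual, (HP x Hx), (HQ y Hy); setoid_rewrite HFG;
    split; try reflexivity; intros t; unfold bounds, recurs;
    setoid_rewrite HFG; reflexivity.
Qed.

Definition decides (P : problem) (F : inst -> nat -> nat -> Prop) (E : code) :=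
  forall x, instance P x -> exists f, maps E (enc x) f /\
    forall n m, f (cpair n m) = 0 <-> F x n m.

(** * Universality of [all_ae_zero] *)

Lemma decides_matrix psi :
  decides (total psi) (fun x n m => bsat (push m (push n x)) (matrix psi))
    (test (funcodes (nnum psi) (nfun psi)) (CSnd :: CFst :: numcodes (nnum psi))
       (matrix psi)).
Proof.
  intros x (Hk & Hl & _). cbn in Hk, Hl. rewrite <- Hk, <- Hl.
  exists (fun p => bval (push (csnd p) (push (cfst p) x)) (matrix psi)). split.
  - intros p.
    apply (eval_test _ _ (funs x) _ (csnd p :: cfst p :: nums x));
      [apply maps_funcodes|].
    repeat constructor. apply eval_numcodes.
  - intros n m. csimp. apply bval_bsat.
Qed.

Lemma presents_matrix psi :
  prefix psi = [Qall; QallInf] ->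
  presents (total psi) (fun x n m => bsat (push m (push n x)) (matrix psi)).
Proof.
  pose proof (decides_matrix psi) as HE.
  revert HE. generalize (test (funcodes (nnum psi) (nfun psi))
    (CSnd :: CFst :: numcodes (nnum psi)) (matrix psi)). intros E HE Hpsi.
  unfold presents, converts, holdsp, witp. cbn -[wit]. rewrite Hpsi.
  cbn [map dualq holds]. split; [reflexivity|]. split; split.
  (* The head of the [n]-th slice is the threshold for [n]. *)
  - exists (CComp cwit (CPair cid CZero)). intros x a Hx Ha.
    exists (fun n => a (cpair n 0)). split.
    + intros n. econstructor; [|apply maps_cwit].
      constructor; [apply eval_id | constructor].
    + intros n m Hm. now apply (Ha n m Hm).
  - exists (skolem_code [Qall; QallInf] [CComp cwit CFst] cinst). intros x t Hx Ht.
    apply skolem_wit with (hs := [fun e => t (cfst e)]).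
    + repeat constructor. intros n. econstructor; [constructor | apply maps_cwit].
    + apply maps_cinst.
    + intros n m. cbn. csimp. apply Ht.
  - exists (CComp cwit CZero). intros x a Hx Ha.
    exists (fun _ => a 0). split.
    + intros n. econstructor; [constructor | apply maps_cwit].
    + exists (a 0). split; [reflexivity|]. intros n. destruct (Ha n) as [Hn [_ H]].
      eauto.
  (* Given the row [p], the choice on input [<n, <p, 0>>] is the least [m >= n] at which the matrix
     fails. *)
  - exists (skolem_code [Qex; QexInf]
      [cwit; search [cwit; osub cinst E] [CSnd; CComp CFst CFst]
        (BAnd (BLe (TVar 1) (TVar 0))
          (BNot (BEq (TApp 1 (TPair (TApp 0 TZero) (TVar 0))) TZero)))] cinst).
    intros x t Hx (p & -> & Hp). destruct (HE x Hx) as (f & Hf & HF).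
    destruct (search_maps (enc_wit (fun _ => p) x) [cwit; osub cinst E]
      [fun _ => p; f] [CSnd; CComp CFst CFst] (fun n i => [i; cfst n])
      (BAnd (BLe (TVar 1) (TVar 0))
          (BNot (BEq (TApp 1 (TPair (TApp 0 TZero) (TVar 0))) TZero))))
      as (h & Hh & Hs).
    + repeat constructor; [apply maps_cwit|].
      eapply maps_osub; [apply maps_cinst | exact Hf].
    + intros n i. repeat constructor; ev.
    + intros n. destruct (Hp (cfst n)) as (m & Hm & H). exists m. cbn.
      now rewrite HF.
    + apply skolem_wit with (hs := [fun _ => p; h]).
      * repeat constructor; [apply maps_cwit | exact Hh].
      * apply maps_cinst.
      * intros n. cbn. destruct (Hs (cpair n (cpair p 0))) as [H _]. cbn in H.
        rewrite HF, cfst_cpair in H. exact H.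
Qed.

Definition all_ae_zero : formula :=
  Formula 0 1 [Qall; QallInf]
    (BEq (TApp 0 (TPair (TVar 1) (TVar 0))) TZero).

(** The output instance is the function computed by [E]: its zeros are the pairs at which [F]
    holds. *)
Lemma le_dm_all_ae_zero P F E :
  presents P F -> decides P F E -> le_dm P (total all_ae_zero).
Proof.
  intros HP HE.
  apply (presents_le_dm _ _ _ _ (joinc [E]) HP (presents_matrix all_ae_zero eq_refl)).
  intros x Hx. destruct (HE x Hx) as (f & Hf & HF). exists (Inst [] [f]).
  destruct Hx as (_ & _ & Hc & _). split; [|split].
  - repeat split. constructor; [|constructor].
    destruct (computable_enc x Hc) as [c Hcx].
    exists (osub c E). now apply maps_osub with (enc x).
  - apply maps_joinc. now repeat constructor.
  - intros n m. now rewrite <- HF.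
Qed.

Lemma all_ae_zero_strictly_dicomplete :
  strictly_dicomplete [Qall; QallInf] all_ae_zero.
Proof.
  split; [reflexivity|]. intros psi Hpsi.
  eapply le_dm_all_ae_zero; [now apply presents_matrix | apply decides_matrix].
Qed.

(** * Lattices *)

(** The guess [g] of stage [m] is also the guess of stage [m + 1]. *)
Definition stable (D : nat -> nat -> Prop) (m : nat) : Prop :=
  exists g, g < S m /\ (forall e, e < S (S m) -> D g e) /\
    forall g', g' < g -> exists e, e < S m /\ ~ D g' e.

(** Induction on [k]: [g] survives all [e <= k + T + 1], and every smaller candidate is refuted by
    some [e <= k + T]. The hypotheses on [g] are those that a search for the guess at [T]
    delivers. *)
Lemma stable_limit D T g :
  (forall m, T <= m -> stable D m) ->
  (forall e, e < S (S T) -> D g e) ->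
  (forall g', (forall e, e < S (S T) -> D g' e) -> g <= g') ->
  forall e, D g e.
Proof.
  intros Hst Hg Hmin.
  assert (H : forall k, (forall e, e < S (S (k + T)) -> D g e) /\
            forall g', g' < g -> exists e, e < S (k + T) /\ ~ D g' e).
  { induction k as [|k [IH1 IH2]].
    - split; [exact Hg|]. destruct (Hst T (le_n T)) as (g0 & _ & H1 & H2).
      intros g' Hg'. apply H2. specialize (Hmin g0 H1). lia.
    - destruct (Hst (S k + T)) as (g0 & _ & H1 & H2); [lia|].
      destruct (Nat.lt_trichotomy g g0) as [Hlt|[<-|Hlt]].
      + destruct (H2 g Hlt) as (e & He & Hne). now apply IH1 in He.
      + auto.
      + destruct (IH2 g0 Hlt) as (e & He & Hne). destruct Hne. apply H1. lia. }
  intros e. apply (H e). lia.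
Qed.

Lemma stable_has_limit D T :
  (forall m, T <= m -> stable D m) -> exists g, forall e, D g e.
Proof.
  intros H. destruct (H T (le_n T)) as (g & _ & H1 & H2). exists g.
  apply (stable_limit D T); auto. intros g' Hg'.
  destruct (le_lt_dec g g') as [|Hlt]; [assumption|].
  destruct (H2 g' Hlt) as (e & He & Hne). destruct Hne. apply Hg'. lia.
Qed.

Lemma stable_of_limit D g :
  (forall e, D g e) -> (forall g', g' < g -> exists e, e <= g /\ ~ D g' e) ->
  forall m, g <= m -> stable D m.
Proof.
  intros H1 H2 m Hm. exists g. split; [lia|]. split; [auto|].
  intros g' Hg'. destruct (H2 g' Hg') as (e & He & H). exists e. split; [lia|auto].
Qed.

(** * Guessing infimum and supremum *)

Definition inf_sup (fs : list (nat -> nat)) (n g e : nat) : Prop :=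
  bsat (Inst [e; g; n] fs) lattice_matrix.

(** Testing [g'] against the right infimum and supremum gives one inequality for each component,
    correctness of [g] the other; antisymmetry concludes. *)
Lemma inf_sup_unique X R n g g' :
  codes_poset X R -> X (cfst n) = 1 -> X (csnd n) = 1 ->
  (forall e, inf_sup [X; R] n g e) ->
  inf_sup [X; R] n g' (cfst g) -> inf_sup [X; R] n g' (csnd g) -> g' = g.
Proof.
  unfold inf_sup. cbn. intros (_ & _ & _ & _ & Hanti & _) Ha Hb Hg Hc Hd.
  destruct (Hg (cfst g')) as [[Xc Xd] Hg1]; [auto|].
  destruct (Hg (csnd g')) as [_ Hg2]; [auto|].
  destruct Hc as [[Xc' Xd'] Hc]; [auto|]. destruct Hd as [_ Hd]; [auto|].
  apply cpair_eq; apply Hanti; firstorder.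
Qed.

(** Both components of [g] are at most [g], so by uniqueness all wrong candidates are refuted by
    stage [g]. *)
Lemma inf_sup_stable X R n g :
  codes_poset X R -> (forall e, inf_sup [X; R] n g e) ->
  forall m, g <= m -> stable (inf_sup [X; R] n) m.
Proof.
  intros HP Hg m Hm.
  destruct (classic (X (cfst n) = 1 /\ X (csnd n) = 1)) as [[Ha Hb]|Hn].
  - apply stable_of_limit with g; auto. intros g' Hg'. apply NNPP. intros H.
    assert (H' : forall e, e <= g -> inf_sup [X; R] n g' e)
      by (intros e He; apply NNPP; eauto).
    enough (g' = g) by lia.
    pose proof (cpair_ge (cfst g) (csnd g)) as Hle. rewrite cpair_eta in Hle.
    apply (inf_sup_unique X R n); auto; apply H'; lia.
  (* If [n] does not code two elements, the matrix is vacuous and the guess is always 0. *)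
  - exists 0. split; [lia|]. split; [|lia]. intros e _ H. now destruct Hn.
Qed.

Definition lattice_test : code :=
  test (funcodes 0 2) [CComp CSnd CSnd; CComp CFst CSnd; CFst] lattice_matrix.

Lemma Lattice_instance x : instance Lattice x ->
  exists X R, x = Inst [] [X; R] /\ codes_poset X R.
Proof.
  destruct x as [ns fs]. intros (Hns & _ & _ & X & R & Hfs & HP). cbn in *.
  exists X, R. subst fs. now destruct ns.
Qed.

Lemma maps_lattice_test X R :
  exists f, maps lattice_test (enc (Inst [] [X; R])) f /\
    forall n g e, f (cpair n (cpair g e)) = 0 <-> inf_sup [X; R] n g e.
Proof.
  exists (fun q => bval (Inst [csnd (csnd q); cfst (csnd q); cfst q] [X; R])
                     lattice_matrix). split.
  - intros q. apply eval_test; [apply (maps_funcodes (Inst [] [X; R]))|].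
    repeat econstructor.
  - intros n g e. rewrite bval_bsat. now repeat csimp.
Qed.

(** Variable 0 is the stage, variable 1 is [n]; the function parameter is nonzero at [<n, <g, e>>]
    iff [e] refutes [g]. *)
Definition stable_form : bform :=
  let refutes n g e := TApp 0 (TPair n (TPair g e)) in
  BEx (TSucc (TVar 0))
    (BAnd (BAll (TSucc (TSucc (TVar 1)))
            (BEq (refutes (TVar 3) (TVar 1) (TVar 0)) TZero))
          (BAll (TVar 0) (BEx (TSucc (TVar 2))
            (BNot (BEq (refutes (TVar 4) (TVar 1) (TVar 0)) TZero))))).

Definition lattice_stable (x : inst) (n m : nat) : Prop :=
  stable (inf_sup (funs x) n) m.

Lemma decides_lattice_stable :
  decides Lattice lattice_stable (test [lattice_test] [CSnd; CFst] stable_form).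
Proof.
  intros x Hx. destruct (Lattice_instance x Hx) as (X & R & -> & _).
  destruct (maps_lattice_test X R) as (f & Hf & HF).
  exists (fun q => bval (Inst [csnd q; cfst q] [f]) stable_form). split.
  - intros q. apply eval_test; repeat constructor. exact Hf.
  - intros n m. csimp. rewrite bval_bsat. cbn. setoid_rewrite HF. reflexivity.
Qed.

Lemma presents_lattice_stable : presents Lattice lattice_stable.
Proof.
  unfold presents, lattice_stable.
  split; [|split; split].
  - intros x Hx. destruct (Lattice_instance x Hx) as (X & R & -> & HP).
    split.
    + intros H n. destruct (H n) as [g Hg]. exists g.
      now apply inf_sup_stable.
    + intros H n. destruct (H n) as [T HT]. now apply stable_has_limit in HT.
  (* The witnessed pair [<c,d>] is itself the threshold. *)
  - exists (CComp cwit (CPair cid CZero)). intros x a Hx Ha.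
    destruct (Lattice_instance x Hx) as (X & R & -> & HP).
    exists (fun n => a (cpair n 0)). split.
    + intros n. econstructor; [|apply maps_cwit].
      constructor; [apply eval_id | constructor].
    + intros n. apply inf_sup_stable; [assumption|]. intros e. apply (Ha n e).
  (* The least [g] passing all tests [e <= t n + 1] is the guess at stage [t n], hence the limit. *)
  - set (p := BAll (TSucc (TSucc (TApp 0 (TVar 1))))
      (BEq (TApp 1 (TPair (TVar 2) (TPair (TVar 1) (TVar 0)))) TZero)).
    exists (skolem_code [Qall; Qex; Qall]
      [CComp (search [cwit; osub cinst lattice_test] [CSnd; CFst] p) CFst] cinst).
    intros x t Hx Ht. destruct (Lattice_instance x Hx) as (X & R & -> & HP).
    destruct (maps_lattice_test X R) as (f & Hf & HF).
    destruct (search_maps (enc_wit t (Inst [] [X; R]))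
      [cwit; osub cinst lattice_test] [t; f] [CSnd; CFst]
      (fun n i => [i; n]) p) as (h & Hh & Hs).
    + repeat constructor; [apply maps_cwit|].
      eapply maps_osub; [apply maps_cinst | exact Hf].
    + intros n i. repeat constructor; ev.
    + intros n. destruct (Ht n (t n) (le_n _)) as (g & _ & H & _). exists g.
      cbn. now setoid_rewrite HF.
    + apply skolem_wit with (hs := [fun e => h (cfst e)]).
      * repeat constructor. intros n. econstructor; [constructor | apply Hh].
      * apply maps_cinst.
      * intros n. cbn -[lattice_matrix bsat]. csimp.
        destruct (Hs n) as [H1 H2]. cbn in H1, H2.
        setoid_rewrite HF in H1. setoid_rewrite HF in H2.
        apply (stable_limit (inf_sup [X; R] n) (t n)); auto.
  - exists (CComp cwit CZero). intros x a Hx Ha.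
    destruct (Lattice_instance x Hx) as (X & R & -> & HP).
    exists (fun _ => a 0). split.
    + intros n. econstructor; [constructor | apply maps_cwit].
    + exists (a 0). split; [reflexivity|]. intros T. apply NNPP. intros H.
      (* Otherwise the guesses for [a 0] have a limit, which the dual witness refutes. *)
      destruct (stable_has_limit (inf_sup [X; R] (a 0)) T) as [g Hg].
      * intros m Hm. apply NNPP. intros H'. eauto.
      * destruct (Ha g) as [_ H']. apply H', Hg.
  - set (p := BNot (BEq (TApp 1
      (TPair (TApp 0 TZero) (TPair (TVar 1) (TVar 0)))) TZero)).
    exists (skolem_code [Qex; Qall; Qex]
      [cwit; search [cwit; osub cinst lattice_test] [CSnd; CComp CFst CFst] p]
      cinst).
    intros x t Hx (q & -> & Hq).
    destruct (Lattice_instance x Hx) as (X & R & -> & HP).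
    destruct (maps_lattice_test X R) as (f & Hf & HF).
    destruct (search_maps (enc_wit (fun _ => q) (Inst [] [X; R]))
      [cwit; osub cinst lattice_test] [fun _ => q; f] [CSnd; CComp CFst CFst]
      (fun n i => [i; cfst n]) p) as (h & Hh & Hs).
    + repeat constructor; [apply maps_cwit|].
      eapply maps_osub; [apply maps_cinst | exact Hf].
    + intros n i. repeat constructor; ev.
    (* The search for a refuting [e] ends: an unrefuted candidate would make all stages from it on
       stable. *)
    + intros n. cbn. setoid_rewrite HF. apply not_all_ex_not. intros H.
      destruct (Hq (cfst n)) as (m & Hm & Hst). apply Hst.
      apply inf_sup_stable with (cfst n); auto.
    + apply skolem_wit with (hs := [fun _ => q; h]).
      * repeat constructor; [apply maps_cwit | exact Hh].
      * apply maps_cinst.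
      * intros g. cbn -[lattice_matrix bsat].
        destruct (Hs (cpair g (cpair q 0))) as [H _]. cbn in H.
        rewrite HF, cfst_cpair in H. exact H.
Qed.

(** * The lattice of gadgets *)

(** The elements are [<0,n>] and [<1,n>] (the two elements to be met), [<2,0>]
    (bottom), [<2,1>] (top) and, for [f <n,m> <> 0], the lower bound [<3,<n,m>>]
    of [<0,n>] and [<1,n>], increasing in [m]. *)
Definition mem_form (t : term) : bform :=
  BOr (BLe (TFst t) (num 1))
    (BOr (BAnd (BEq (TFst t) (num 2)) (BLe (TSnd t) (num 1)))
         (BAnd (BEq (TFst t) (num 3)) (BNot (BEq (TApp 0 (TSnd t)) TZero)))).

Definition le_form (s t : term) : bform :=
  BAnd (BAnd (mem_form s) (mem_form t))
    (BOr (BEq s t)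
    (BOr (BAnd (BEq (TFst s) (num 2)) (BEq (TSnd s) (num 0)))
    (BOr (BAnd (BEq (TFst t) (num 2)) (BEq (TSnd t) (num 1)))
         (BAnd (BEq (TFst s) (num 3))
           (BOr (BAnd (BLe (TFst t) (num 1)) (BEq (TFst (TSnd s)) (TSnd t)))
                (BAnd (BEq (TFst t) (num 3))
                  (BAnd (BEq (TFst (TSnd s)) (TFst (TSnd t)))
                        (BLe (TSnd (TSnd s)) (TSnd (TSnd t)))))))))).

Definition charf (p : bform) (f : nat -> nat) (n : nat) : nat :=
  1 - bval (Inst [n] [f]) p.

Definition charc (p : bform) : code :=
  CComp csub (CPair (numc 1) (test [COracle] [cid] p)).

Lemma maps_charc p f : maps (charc p) f (charf p f).
Proof.
  intros n. econstructor; [constructor; [apply eval_num|] | apply eval_sub].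
  apply eval_test; repeat econstructor. rewrite <- (cpair_eta n) at 2.
  repeat constructor.
Qed.

Lemma charf_le p f n : charf p f n <= 1.
Proof. unfold charf. lia. Qed.

Lemma charf_1 p f n : charf p f n = 1 <-> bsat (Inst [n] [f]) p.
Proof. rewrite <- bval_bsat. unfold charf. lia. Qed.

Definition carrier : bform := mem_form (TVar 0).
Definition order : bform := le_form (TFst (TVar 0)) (TSnd (TVar 0)).

Definition mem (f : nat -> nat) (u : nat) : Prop :=
  cfst u <= 1 \/ (cfst u = 2 /\ csnd u <= 1) \/ (cfst u = 3 /\ f (csnd u) <> 0).

Definition below (f : nat -> nat) (u v : nat) : Prop :=
  (mem f u /\ mem f v) /\
  (u = v \/ (cfst u = 2 /\ csnd u = 0) \/ (cfst v = 2 /\ csnd v = 1) \/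
   (cfst u = 3 /\
     ((cfst v <= 1 /\ cfst (csnd u) = csnd v) \/
      (cfst v = 3 /\ cfst (csnd u) = cfst (csnd v) /\
       csnd (csnd u) <= csnd (csnd v))))).

Lemma charf_carrier f u : charf carrier f u = 1 <-> mem f u.
Proof. apply charf_1. Qed.

Lemma charf_order f u v : charf order f (cpair u v) = 1 <-> below f u v.
Proof. rewrite charf_1. cbn. now csimp. Qed.

Lemma gadget_poset f : codes_poset (charf carrier f) (charf order f).
Proof.
  unfold codes_poset. repeat setoid_rewrite charf_order.
  repeat setoid_rewrite charf_carrier.
  split; [intros; apply charf_le|]. split; [intros; apply charf_le|].
  split; [now intros a b []|]. split; [now split; auto|].
  split.
  - intros a b [_ H1] [_ H2].
    destruct (Nat.eq_dec a b) as [|Hne]; [assumption|].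
    (* For chain elements the second component is again a pair, to be compared coordinatewise. *)
    apply cpair_eq; [lia|]. destruct (Nat.eq_dec (cfst a) 3); [|lia].
    apply cpair_eq; lia.
  - intros a b c [[Ha Hb] H1] [[_ Hc] H2]. split; [auto|].
    destruct H1 as [->|H1]; [assumption|].
    destruct H2 as [<-|H2]; [auto|]. right. lia.
Qed.

Definition gadgets (f : nat -> nat) : list (nat -> nat) :=
  [charf carrier f; charf order f].

Lemma gadgets_inf_sup f n g e :
  inf_sup (gadgets f) n g e <->
  (mem f (cfst n) /\ mem f (csnd n) ->
   (mem f (cfst g) /\ mem f (csnd g)) /\
   (mem f e ->
     ((below f (cfst g) (cfst n) /\ below f (cfst g) (csnd n)) /\
      (below f (cfst n) (csnd g) /\ below f (csnd n) (csnd g))) /\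
     ((below f e (cfst n) /\ below f e (csnd n) -> below f e (cfst g)) /\
      (below f (cfst n) e /\ below f (csnd n) e -> below f (csnd g) e)))).
Proof.
  unfold inf_sup. cbn. repeat setoid_rewrite charf_order.
  repeat setoid_rewrite charf_carrier. reflexivity.
Qed.

(** * Infima and suprema of gadget elements *)

Lemma last_nonzero (f : nat -> nat) T :
  (forall m, T <= m -> f m = 0) ->
  (forall m, f m = 0) \/
  exists m, m < T /\ f m <> 0 /\ forall m', f m' <> 0 -> m' <= m.
Proof.
  intros H. induction T as [|T IH]; [left; intros; apply H; lia|].
  destruct (Nat.eq_dec (f T) 0) as [E|E].
  - assert (H0 : forall m, T <= m -> f m = 0).
    { intros m Hm. destruct (Nat.eq_dec m T) as [->|]; [assumption|].
      apply H. lia. }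
    destruct (IH H0) as [IH'|(m & Hm & H')]; [now left|].
    right. exists m. split; [lia | assumption].
  - right. exists T. split; [lia|]. split; [assumption|]. intros m Hm.
    destruct (le_lt_dec m T); [assumption|]. destruct Hm. apply H. lia.
Qed.

Lemma mem_chain f u : mem f u -> cfst u = 3 -> f (csnd u) <> 0.
Proof. unfold mem. lia. Qed.

(** Comparable elements are their own infimum and supremum. Otherwise the supremum is the top, and
    the infimum is the bottom or, for the two elements of one gadget, the last chain element if
    there is one. [B] bounds the codes of all these. *)
Lemma gadget_inf_sup_exists f T B a b :
  mem f a -> mem f b -> (forall m, T <= m -> f (cpair (csnd a) m) = 0) ->
  a <= B -> b <= B -> cpair 2 0 <= B -> cpair 2 1 <= B ->
  cpair 3 (cpair (csnd a) T) <= B ->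
  exists c d, c <= B /\ d <= B /\
    (below f c a /\ below f c b) /\ (below f a d /\ below f b d) /\
    forall e, (below f e a /\ below f e b -> below f e c) /\
              (below f a e /\ below f b e -> below f d e).
Proof.
  intros Ha Hb HT HaB HbB HbotB HtopB HTB.
  destruct (gadget_poset f) as (_ & _ & Hmem & Hrefl & Hanti & Htrans).
  repeat setoid_rewrite charf_order in Hmem.
  repeat setoid_rewrite charf_carrier in Hmem.
  repeat setoid_rewrite charf_order in Hrefl.
  repeat setoid_rewrite charf_carrier in Hrefl.
  repeat setoid_rewrite charf_order in Htrans.
  destruct (classic (below f a b)) as [Hab|Hab].
  { exists a, b. split; [assumption|]. split; [assumption|].
    split; [auto|]. split; [auto|]. tauto. }
  destruct (classic (below f b a)) as [Hba|Hba].
  { exists b, a. split; [assumption|]. split; [assumption|].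
    split; [auto|]. split; [auto|]. tauto. }
  assert (Hinc : forall u v, mem f u -> mem f v -> ~ below f u v -> ~ (u = v \/
    (cfst u = 2 /\ csnd u = 0) \/ (cfst v = 2 /\ csnd v = 1) \/
    (cfst u = 3 /\
     ((cfst v <= 1 /\ cfst (csnd u) = csnd v) \/
      (cfst v = 3 /\ cfst (csnd u) = cfst (csnd v) /\
       csnd (csnd u) <= csnd (csnd v))))))
    by (intros u v Hu Hv H1 H2; apply H1; now split).
  pose proof (Hinc a b Ha Hb Hab) as Hab'.
  pose proof (Hinc b a Hb Ha Hba) as Hba'.
  assert (Htop : forall u, mem f u -> below f u (cpair 2 1)).
  { intros u Hu. unfold below, mem. csimp. split; [split; [exact Hu|lia]|lia]. }
  assert (Hbot : forall u, mem f u -> below f (cpair 2 0) u).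
  { intros u Hu. unfold below, mem. csimp. split; [split; [lia|exact Hu]|lia]. }
  (* A common upper bound other than the top would make [a] and [b] elements of one chain, hence
     comparable. *)
  assert (Hup : forall e, below f a e /\ below f b e -> below f (cpair 2 1) e).
  { intros e [Hae Hbe].
    destruct (Nat.eq_dec a e) as [<-|Hne1]; [contradiction|].
    destruct (Nat.eq_dec b e) as [<-|Hne2]; [contradiction|].
    destruct Hae as [[_ He] Hae], Hbe as [_ Hbe].
    split; [split; [right; left; csimp; lia | exact He]|]. csimp.
    right; right; left.
    assert (Hor : csnd (csnd a) <= csnd (csnd b) \/ csnd (csnd b) <= csnd (csnd a))
      by lia.
    clear - Hne1 Hne2 Hae Hbe Hab' Hba' Hor.
    destruct Hae as [|[|[|[? [|]]]]], Hbe as [|[|[|[? [|]]]]], Hor;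
      first [contradiction | assumption
        | exfalso; apply Hab'; clear Hab' Hba'; lia
        | exfalso; apply Hba'; clear Hab' Hba'; lia]. }
  (* A common lower bound other than the bottom is a chain element of a gadget to which [a] and [b]
     belong; were one of them in the chain, they would be comparable. *)
  assert (Hdown : forall e, below f e a /\ below f e b ->
    (cfst e = 2 /\ csnd e = 0) \/
    (cfst a <= 1 /\ cfst b <= 1 /\ csnd a = csnd b /\ cfst e = 3 /\
     cfst (csnd e) = csnd a)).
  { intros e [Hae Hbe].
    destruct (Nat.eq_dec e a) as [->|Hne1]; [contradiction|].
    destruct (Nat.eq_dec e b) as [->|Hne2]; [contradiction|].
    destruct Hae as [_ Hae], Hbe as [_ Hbe].
    assert (Hor : csnd (csnd a) <= csnd (csnd b) \/ csnd (csnd b) <= csnd (csnd a))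
      by lia.
    clear - Hne1 Hne2 Hae Hbe Hab' Hba' Hor.
    destruct Hae as [|[|[|[? [|]]]]], Hbe as [|[|[|[? [|]]]]], Hor;
      first [contradiction | left; assumption
        | exfalso; apply Hab'; clear Hab' Hba'; lia
        | exfalso; apply Hba'; clear Hab' Hba'; lia
        | clear Hab' Hba'; lia]. }
  assert (Hc : exists c, c <= B /\
    (below f c a /\ below f c b) /\
    forall e, below f e a /\ below f e b -> below f e c).
  { destruct (classic (cfst a <= 1 /\ cfst b <= 1 /\ csnd a = csnd b))
      as [(Ha1 & Hb1 & Heq)|Hgad].
    2: { exists (cpair 2 0). split; [assumption|]. split; [auto|]. intros e He.
         destruct (Hdown e He) as [[E1 E2]|]; [|tauto].
         replace e with (cpair 2 0) by (apply cpair_eq; csimp; auto).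
         now apply Hrefl, (Hmem _ a), Hbot. }
    destruct (last_nonzero (fun m => f (cpair (csnd a) m)) T HT)
      as [H0|(m & Hm & Hfm & Hlast)].
    - exists (cpair 2 0). split; [assumption|]. split; [auto|]. intros e He.
      destruct (Hdown e He) as [[E1 E2]|(_ & _ & _ & E1 & E2)].
      + replace e with (cpair 2 0) by (apply cpair_eq; csimp; auto).
        now apply Hrefl, (Hmem _ a), Hbot.
      + destruct He as [He _]. destruct (Hmem e a He) as [Hme _].
        destruct (mem_chain f e Hme E1).
        rewrite <- (cpair_eta (csnd e)), E2. apply H0.
    - exists (cpair 3 (cpair (csnd a) m)). split; [|split].
      + etransitivity; [|exact HTB].
        apply cpair_mono; [apply le_n|].
        apply cpair_mono; [apply le_n | now apply Nat.lt_le_incl].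
      + assert (Hmem' : mem f (cpair 3 (cpair (csnd a) m)))
          by (right; right; now csimp).
        split; (split; [now split|]); repeat csimp; right; right; right; auto.
      + intros e He. pose proof (Hmem e a (proj1 He)) as [Hme _].
        split; [split; [exact Hme | right; right; now csimp]|].
        repeat csimp.
        destruct (Hdown e He) as [[E1 E2]|(_ & _ & _ & E1 & E2)]; [auto|].
        right. right. right. split; [assumption|]. right.
        split; [reflexivity|]. split; [assumption|].
        apply Hlast. rewrite <- E2, cpair_eta. now apply mem_chain. }
  destruct Hc as (c & Hcle & Hc1 & Hc2).
  exists c, (cpair 2 1). split; [assumption|]. split; [assumption|].
  split; [assumption|]. split; [auto|]. auto.
Qed.

(** [B] is at least each possible infimum and supremum, so [cpair B B] bounds the right pair. A sum
    replaces the maximum because it is expressible as a term. *)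
Definition gadget_bound (T n : nat) : nat :=
  let B := cfst n + csnd n + (cpair 2 0 + cpair 2 1 +
             cpair 3 (cpair (csnd (cfst n)) T)) in
  cpair B B.

Lemma gadget_limit f T n :
  (forall m, T <= m -> f (cpair (csnd (cfst n)) m) = 0) ->
  exists g, g <= gadget_bound T n /\ forall e, inf_sup (gadgets f) n g e.
Proof.
  intros HT.
  destruct (classic (mem f (cfst n) /\ mem f (csnd n))) as [[Ha Hb]|Hn].
  - assert (HB : forall p q x y z, let B := p + q + (x + y + z) in
      p <= B /\ q <= B /\ x <= B /\ y <= B /\ z <= B) by (cbv zeta; lia).
    destruct (HB (cfst n) (csnd n) (cpair 2 0) (cpair 2 1)
      (cpair 3 (cpair (csnd (cfst n)) T))) as (B1 & B2 & B3 & B4 & B5).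
    destruct (gadget_inf_sup_exists f T _ _ _ Ha Hb HT B1 B2 B3 B4 B5)
      as (c & d & Hc & Hd & H1 & H2 & H3).
    exists (cpair c d). split; [now apply cpair_mono|].
    intros e. rewrite gadgets_inf_sup, cfst_cpair, csnd_cpair. intros _.
    split; [split; [apply H1 | apply H2]|]. auto.
  - exists 0. split; [apply Nat.le_0_l|]. intros e. rewrite gadgets_inf_sup. tauto.
Qed.

(** If [f <n,m> <> 0], then [<3,<n,m>>] lies below the infimum, which must therefore be a chain
    element [<3,<n,m'>>] with [m <= m']. *)
Lemma gadget_inf_bounds f n g :
  (forall e, inf_sup (gadgets f) (cpair (cpair 0 n) (cpair 1 n)) g e) ->
  forall m, S (csnd (csnd (cfst g))) <= m -> f (cpair n m) = 0.
Proof.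
  intros Hg m Hm.
  destruct (Nat.eq_dec (f (cpair n m)) 0) as [|Hf]; [assumption|]. exfalso.
  specialize (Hg (cpair 3 (cpair n m))). rewrite gadgets_inf_sup in Hg.
  repeat rewrite ?cfst_cpair, ?csnd_cpair in Hg.
  assert (Ha : mem f (cpair 0 n)) by (left; csimp; lia).
  assert (Hb : mem f (cpair 1 n)) by (left; csimp; lia).
  assert (Hc : mem f (cpair 3 (cpair n m))) by (right; right; now csimp).
  destruct Hg as [_ Hg]; [now split|].
  destruct (Hg Hc) as [[[[_ Hga] [_ Hgb]] _] [[_ H] _]].
  - split; (split; [now split|]); repeat csimp; right; right; right;
      split; auto; left; split; auto.
  - repeat rewrite ?cfst_cpair, ?csnd_cpair in H.
    destruct H as [E|H].
    + rewrite <- E in Hm. repeat rewrite ?csnd_cpair in Hm. lia.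
    (* The infimum is neither [<0,n>] nor [<1,n>], as these are incomparable. *)
    + destruct Hga as [E|Hga]; [rewrite E in Hgb|];
        repeat rewrite ?cfst_cpair, ?csnd_cpair in *;
        [destruct Hgb as [E'|Hgb]; [apply (f_equal cfst) in E'|];
         repeat rewrite ?cfst_cpair in *; lia | lia].
Qed.

(** * The lattice problem on gadget orders *)

(** Restricting the instances lets the conversion of witnesses exploit the shape of the order. *)
Definition Gadget : problem :=
  Problem (body Lattice) (fun x => exists f, funs x = gadgets f).

Lemma Gadget_Lattice x : instance Gadget x -> instance Lattice x.
Proof.
  intros (Hns & Hfs & Hc & f & Hf). repeat split; try assumption.
  exists (charf carrier f), (charf order f). split; [exact Hf | apply gadget_poset].
Qed.

(** This is [f <n,m> = 0] read off the carrier, as the instance contains the order and not [f]. *)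
Definition gadget_zero (x : inst) (n m : nat) : Prop :=
  nth 0 (funs x) (fun _ => 0) (cpair 3 (cpair n m)) <> 1.

Lemma gadget_zero_iff f n m :
  gadget_zero (Inst [] (gadgets f)) n m <-> f (cpair n m) = 0.
Proof.
  unfold gadget_zero, gadgets. cbn [funs nth]. rewrite charf_carrier.
  unfold mem. csimp. lia.
Qed.

Lemma Gadget_instance x : instance Gadget x ->
  exists f, x = Inst [] (gadgets f).
Proof.
  destruct x as [ns fs]. intros (Hns & _ & _ & f & Hf). cbn in *.
  exists f. subst fs. now destruct ns.
Qed.

(** Witnesses for [Lattice] and its dual come from [presents_lattice_stable], once thresholds of
    stability or an unstable pair are supplied. *)
Lemma presents_gadget_zero : presents Gadget gadget_zero.
Proof.
  destruct presents_lattice_stable as (_ & [_ [v Hv]] & [_ [z Hz]]).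
  unfold presents. split; [|split; split].
  - intros x Hx. destruct (Gadget_instance x Hx) as [f ->].
    setoid_rewrite gadget_zero_iff. split.
    + intros H n. destruct (H (cpair (cpair 0 n) (cpair 1 n))) as [g Hg].
      exists (S (csnd (csnd (cfst g)))). now apply gadget_inf_bounds.
    + intros H n. destruct (H (csnd (cfst n))) as [T HT].
      destruct (gadget_limit f T n HT) as (g & _ & Hg). now exists g.
  (* The threshold is one more than the chain position of the witnessed infimum of [<0,n>] and
     [<1,n>]. *)
  - exists (CComp CSucc (CComp CSnd (CComp CSnd (CComp CFst (CComp cwit
      (CPair (CPair (CPair CZero cid) (CPair (numc 1) cid)) CZero)))))).
    intros x a Hx Ha. destruct (Gadget_instance x Hx) as [f ->].
    exists (fun n => S (csnd (csnd (cfst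
      (a (cpair (cpair (cpair 0 n) (cpair 1 n)) 0)))))). split.
    + intros n. do 4 (econstructor; [|constructor]).
      econstructor; [|apply maps_cwit].
      repeat first [apply eval_id | apply eval_num | constructor].
    + intros n m. rewrite gadget_zero_iff. apply gadget_inf_bounds.
      intros e. apply (Ha (cpair (cpair 0 n) (cpair 1 n)) e).
  - set (B := TAdd (TAdd (TFst (TVar 0)) (TSnd (TVar 0)))
      (TAdd (TAdd (TPair (num 2) (num 0)) (TPair (num 2) (num 1)))
        (TPair (num 3) (TPair (TSnd (TFst (TVar 0)))
          (TApp 0 (TSnd (TFst (TVar 0)))))))).
    exists (osub (joinc [CComp (tcode [cwit] (TPair B B)) (envcode [cid]); cinst]) v).
    intros x t Hx Ht. destruct (Gadget_instance x Hx) as [f ->].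
    destruct (Hv _ (fun n => gadget_bound (t (csnd (cfst n))) n)
      (Gadget_Lattice _ Hx)) as (b & Hb & Hw).
    + intros n m Hm.
      destruct (gadget_limit f (t (csnd (cfst n))) n) as (g & Hg & Hlim).
      * intros k Hk. apply gadget_zero_iff. now apply Ht.
      * apply (inf_sup_stable _ _ n g (gadget_poset f)); [exact Hlim | lia].
    + exists b. split; [|exact Hw]. eapply maps_osub; [|exact Hb].
      apply maps_enc_wit; [|apply maps_cinst]. intros n.
      econstructor;
        [apply eval_env with (ns := [n]); repeat constructor; apply eval_id|].
      apply eval_tcode with (gs := [t]). repeat constructor. apply maps_cwit.
  (* By contraposition of [gadget_limit], the chain with index [csnd (cfst (a 0))] is infinite. *)
  - exists (CComp CSnd (CComp CFst (CComp cwit CZero))). intros x a Hx Ha.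
    destruct (Gadget_instance x Hx) as [f ->].
    exists (fun _ => csnd (cfst (a 0))). split.
    + intros n. do 2 (econstructor; [|constructor]).
      econstructor; [constructor | apply maps_cwit].
    + eexists. split; [reflexivity|]. intros T. apply NNPP. intros H.
      destruct (gadget_limit f T (a 0)) as (g & _ & Hg).
      * intros m Hm. apply gadget_zero_iff. apply NNPP. eauto.
      * destruct (Ha g) as [_ H']. apply H', Hg.
  (* An infinite chain at [q] leaves [<0,q>] and [<1,q>] without infimum, so their guesses never
     stabilise. *)
  - exists (osub (joinc [CPair (CPair CZero cwit) (CPair (numc 1) cwit); cinst]) z).
    intros x t Hx (q & -> & Hq). destruct (Gadget_instance x Hx) as [f ->].
    destruct (Hz _ (fun _ => cpair (cpair 0 q) (cpair 1 q))
      (Gadget_Lattice _ Hx)) as (b & Hb & Hw).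
    + eexists. split; [reflexivity|]. intros T. apply NNPP. intros H.
      destruct (stable_has_limit
        (inf_sup (gadgets f) (cpair (cpair 0 q) (cpair 1 q))) T) as [g Hg].
      * intros m Hm. apply NNPP. eauto.
      * destruct (Hq (S (csnd (csnd (cfst g))))) as (m & Hm & Hnz).
        apply Hnz, gadget_zero_iff. now apply (gadget_inf_bounds f q g).
    + exists b. split; [|exact Hw]. eapply maps_osub; [|exact Hb].
      apply maps_enc_wit; [|apply maps_cinst]. intros n.
      repeat first [apply maps_cwit | apply eval_num | constructor].
Qed.

(** The same instances are output, and they stay admissible in the larger class. *)
Lemma le_dm_adm P phi (A B : inst -> Prop) :
  (forall x, A x -> B x) -> le_dm P (Problem phi A) -> le_dm P (Problem phi B).
Proof.
  intros HAB (eta & [rm [rp H]] & [rm' [rp' H']]). exists eta. split.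
  - exists rm, rp. intros x Hx. destruct (H x Hx) as (y & (H1 & H2 & H3 & H4) & Hy).
    exists y. split; [repeat split; auto; now apply HAB | exact Hy].
  - exists rm', rp'. intros x Hx.
    destruct (H' x Hx) as (y & (H1 & H2 & H3 & H4) & Hy).
    exists y. split; [repeat split; auto; now apply HAB | exact Hy].
Qed.

Lemma all_ae_zero_le_dm_Gadget : le_dm (total all_ae_zero) Gadget.
Proof.
  apply (presents_le_dm _ _ _ _ (joinc [charc carrier; charc order])
    (presents_matrix all_ae_zero eq_refl) presents_gadget_zero).
  intros [ns fs] (Hns & Hfs & Hc & _). cbn in Hns, Hfs, Hc.
  destruct ns; [|discriminate]. destruct fs as [|f [|]]; try discriminate.
  replace (enc (Inst [] [f])) with f by (symmetry; apply join_1).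
  exists (Inst [] (gadgets f)).
  inversion Hc as [|? ? [c Hcf] _]; subst. split; [|split].
  - split; [reflexivity|]. split; [reflexivity|]. split; [|now exists f].
    repeat constructor;
      (eexists; eapply maps_osub; [exact Hcf | apply maps_charc]).
  - apply maps_joinc. repeat constructor; apply maps_charc.
  - intros n m. rewrite gadget_zero_iff. reflexivity.
Qed.

Theorem theorem3p10 : dicomplete [Qall; QallInf] Lattice.
Proof.
  exists all_ae_zero. split; [apply all_ae_zero_strictly_dicomplete|]. split.
  - eapply le_dm_all_ae_zero;
      [apply presents_lattice_stable | apply decides_lattice_stable].
  - eapply le_dm_adm; [|apply all_ae_zero_le_dm_Gadget].
    intros x (f & Hf). exists (charf carrier f), (charf order f).
    split; [exact Hf | apply gadget_poset].
Qed.
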